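(* Let $G=A\star B$ be a free product of two nontrivial finitely generated groups that is not elementary (i.e. $G\not\cong\mathbb Z_2\star\mathbb Z_2$). Then, with respect to the word metric of any finite generating set, the set of elements of $G$ that are not conjugate into either of the factors $A$, $B$ is exponentially generic.
   Context: For the word metric $d_S$ of a finite generating set $S$ of $G$, $N(1,n)=\{g\in G:d_S(1,g)\le n\}$; a subset $X\subset G$ is exponentially generic if $\sharp(N(1,n)\cap X)/\sharp N(1,n)\to1$ exponentially fast as $n\to\infty$. *)

(* Defs.v *)
From HB Require Import structures.
From mathcomp Require Import all_boot all_order all_algebra all_fingroup.
From mathcomp Require Import finmap.
From mathcomp Require Import boolp classical_sets functions cardinality reals.

Set Implicit Arguments.
Unset Strict Implicit.
Unset Printing Implicit Defensive.

Import Order.TTheory GRing.Theory Num.Theory.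

Local Open Scope classical_set_scope.
Local Open Scope group_scope.

(* [G] is the free product of [A] and [B], with canonical maps [iA] and [iB]:
   it is the coproduct of [A] and [B] in the category of groups (so that [iA]
   and [iB] are injective). A multiplicative map between groups is a group
   homomorphism. *)
Definition is_free_product (A B G : groupType)
    (iA : {multiplicative A -> G}) (iB : {multiplicative B -> G}) : Prop :=
  forall (H : groupType)
         (f : {multiplicative A -> H}) (g : {multiplicative B -> H}),
    exists2 h : {multiplicative G -> H},
      h \o iA =1 f /\ h \o iB =1 g &
      forall h' : {multiplicative G -> H},
        h' \o iA =1 f /\ h' \o iB =1 g -> h' =1 h.

(* 'Z_2 carries here its additive group structure, written multiplicatively. *)
Definition iso_Z2_free_Z2 (G : groupType) : Prop :=
  exists i j : {multiplicative 'Z_2 -> G}, is_free_product i j.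

Definition nontrivial (G : groupType) : Prop := exists x : G, x != 1.

Section WordMetric.
Variables (G : groupType) (S : {fset G}).

Definition is_word (w : seq G) : bool :=
  all (fun x => (x \in S) || (x^-1 \in S)) w.

Definition generates : Prop :=
  forall g : G, exists2 w : seq G, is_word w & \prod_(x <- w) x = g.

Definition joined_by_word_of_size (x y : G) (n : nat) : Prop :=
  exists w : seq G, [/\ is_word w, size w = n & \prod_(z <- w) z = x^-1 * y].

(* The least length of a word in [S] and its inverses representing [x^-1 * y].
   The default value 0 is never taken when [S] generates [G]. *)
Definition word_dist (x y : G) : nat :=
  match pselect (exists n, `[< joined_by_word_of_size x y n >]) with
  | left ex => ex_minn ex
  | right _ => 0%N
  end.

Definition word_ball (x : G) (n : nat) : set G :=
  [set g | (word_dist x g <= n)%N].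

End WordMetric.

Definition finitely_generated (G : groupType) : Prop :=
  exists S : {fset G}, generates S.

Section ExponentiallyGeneric.
Local Open Scope ring_scope.

Definition cvg_exponentially (R : realType) (u : nat -> R) (l : R) : Prop :=
  exists C lambda : R, [/\ 0 < C, 0 < lambda < 1 &
    forall n : nat, `|u n - l| <= C * lambda ^+ n].

(* [fset_set] only makes sense on finite sets; balls are finite when [S]
   generates [G], since [S] is finite. *)
Definition ball_proportion (R : realType) (G : groupType) (S : {fset G})
    (X : set G) (n : nat) : R :=
  (#|` fset_set (word_ball S 1%g n `&` X)|%fset)%:R
  / (#|` fset_set (word_ball S 1%g n)|%fset)%:R.

Definition exponentially_generic (R : realType) (G : groupType)
    (S : {fset G}) (X : set G) : Prop :=
  cvg_exponentially (ball_proportion R S X) 1.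

End ExponentiallyGeneric.

Definition conjugate_into (A G : groupType) (iA : A -> G) (g : G) : Prop :=
  exists (a : A) (x : G), g = iA a ^ x.

(* Main.v *)
Require Import Defs.
From HB Require Import structures.
From mathcomp Require Import all_boot all_order all_algebra all_fingroup.
From mathcomp Require Import finmap.
From mathcomp Require Import boolp classical_sets functions cardinality reals.
From mathcomp Require Import zify ring lra.

(** Call an element elliptic if it is conjugate into a factor. By the symmetry
    between [A] and [B] it is enough to show that the ball of radius [n] contains
    at most [C (n+1)^3 2^(-n/T)] times its cardinal of conjugates of elements of
    [A]; this is [elliptic_growth_tight].

    The geometry is that of a tree. For [g] in [G] let [pA g] be the first
    syllable of the normal form of [g] if it lies in [A], and [1] otherwise: this
    is the nearest point projection onto the coset [A] in the tree of cosets.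
    Right multiplication by a single syllable changes [pA] only at points of [A].
    A generator is a bounded product of syllables, so that an edge of the Cayley
    graph can change [pA] only within a bounded distance [D] of the coset, near
    the projection itself ([bottleneck_exists]). It follows that when [x] does not
    end in [A] and [y] does not begin in [A], a path from [1] to [x a y], with
    [a <> 1], passes within [D] of [x] and of [x a] ([passes_near]), and that a
    geodesic from [1] to an element of [A] stays close to [A]
    ([milestones_exist]).

    A nontrivial conjugate of an element of [A] is [x a x^-1] with [x] not ending
    in [A] and [a <> 1]. Put [k = |x|] and [m = |a|]; then [2 k + m] is at most
    [n + 4 D]. Such an element wastes length in two ways.
    - Its last factor [x^-1] could be any [y] of length about [n - k - m] that does
      not begin in [A]. The hypothesis that [G] is not elementary yields two distinct
      pairs [(b, a)] of nontrivial syllables; the products [b a] generate a free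
      monoid, so there are exponentially many such [y] ([free_submonoid]).
    - The element [a] can be cut at [r] places along its geodesic, and a fixed
      nontrivial [t] in [B] inserted at each of them. An insertion lengthens the
      word by a constant [L], which enlarges the ball by at most the factor
      [(growth 1)^L]; but each place is chosen among [Q = 2 (growth 1)^L], so each
      insertion gains a factor [2]. The number [r] of insertions is proportional
      to [m] ([insertion_images]).
    Together these turn [x a x^-1] into [2^(r+j)] elements, after accounting for
    the larger ball, where [r + j] grows linearly in [m + (n - k - m) = n - k],
    which is at least about [n/2]. Conversely, from one of the new elements one
    recovers [x], up to a number of choices linear in [n], because the geodesic
    passes near [x]; and then [a], exactly, by reading off syllables ([peel]).
    Double counting gives the bound for each pair [(k, m)] ([elliptic_count],
    [elliptic_of_size_bound]), and summing over the pairs costs a factor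
    quadratic in [n]. *)

Local Open Scope classical_set_scope.
Local Open Scope group_scope.

Set Implicit Arguments.
Unset Strict Implicit.
Unset Printing Implicit Defensive.

(** * The free product acts, and is generated by its factors *)

(** The symmetric group of [T]. The inverse is part of the data, so that the group
    operations are defined without choice. *)
Record bijection (T : Type) := Bijection {
  bij_fun : T -> T;
  bij_inv : T -> T;
  bij_funK : cancel bij_fun bij_inv;
  bij_invK : cancel bij_inv bij_fun }.

Lemma bijection_eq (T : Type) (p q : bijection T) :
  bij_fun p = bij_fun q -> p = q.
Proof.
case: p q => [f f' fK f'K] [g g' gK g'K] /= efg; subst g.
have e' : f' = g' by apply/funext => x; rewrite -[x in LHS]g'K fK.
by subst g'; congr Bijection; apply: Prop_irrelevance.
Qed.

HB.instance Definition _ (T : Type) := gen_eqMixin (bijection T).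
HB.instance Definition _ (T : Type) := gen_choiceMixin (bijection T).

Section SymmetricGroup.
Variable T : Type.
Implicit Types p q r : bijection T.

Definition bij_one := @Bijection T id id (fun=> erefl) (fun=> erefl).
Definition bij_opp p := Bijection (bij_invK p) (bij_funK p).
Definition bij_mul p q :=
  Bijection (can_comp (bij_funK p) (bij_funK q))
            (can_comp (bij_invK q) (bij_invK p)).

Let bij_mulA : associative bij_mul. Proof. by move=> p q r; apply: bijection_eq. Qed.
Let bij_mul1 : left_id bij_one bij_mul. Proof. by move=> p; apply: bijection_eq. Qed.
Let bij_1mul : right_id bij_one bij_mul. Proof. by move=> p; apply: bijection_eq. Qed.
Let bij_mulV : left_inverse bij_one bij_opp bij_mul.
Proof. by move=> p; apply: bijection_eq; apply/funext => x /=; rewrite bij_funK. Qed.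
Let bij_Vmul : right_inverse bij_one bij_opp bij_mul.
Proof. by move=> p; apply: bijection_eq; apply/funext => x /=; rewrite bij_invK. Qed.

HB.instance Definition _ := isGroup.Build (bijection T)
  bij_mulA bij_mul1 bij_1mul bij_mulV bij_Vmul.
End SymmetricGroup.

Definition left_action (A : groupType) (T : Type) (act : A -> T -> T) : Prop :=
  (forall x, act 1 x = x) /\ (forall a b x, act (a * b) x = act a (act b x)).

Lemma action_morphism (A : groupType) (T : Type) (act : A -> T -> T) :
  left_action act ->
  exists f : {multiplicative A -> bijection T}, forall a, bij_fun (f a) = act a.
Proof.
move=> [act1 actM].
have K a : cancel (act a) (act a^-1) by move=> x; rewrite -actM mulVg act1.
have K' a : cancel (act a^-1) (act a) by move=> x; rewrite -actM mulgV act1.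
pose f a : bijection T := Bijection (K a) (K' a).
have fM : {morph f : x y / x * y}.
  by move=> a b; apply: bijection_eq; apply/funext => x; apply: actM.
pose F : {multiplicative A -> bijection T} :=
  HB.pack f (isMultiplicative.Build A (bijection T) f fM).
by exists F.
Qed.

Lemma group_morph1 (H K : groupType) (f : {multiplicative H -> K}) : f 1 = 1.
Proof. by apply: (mulgI (f 1)); rewrite -gmulfM !mulg1. Qed.

Lemma group_morphV (H K : groupType) (f : {multiplicative H -> K}) :
  {morph f : x / x^-1}.
Proof.
by move=> x; apply: (mulgI (f x)); rewrite -gmulfM !mulgV group_morph1.
Qed.

Section FreeProduct.
Variables (A B G : groupType).
Variables (iA : {multiplicative A -> G}) (iB : {multiplicative B -> G}).
Hypothesis hG : is_free_product iA iB.

(** The universal property applied to the symmetric group of [T]: this is how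
    concrete information about [G] is obtained. *)
Lemma free_product_action (T : Type) (actA : A -> T -> T) (actB : B -> T -> T) :
  left_action actA -> left_action actB ->
  exists act : G -> T -> T, [/\ left_action act,
    forall a x, act (iA a) x = actA a x & forall b x, act (iB b) x = actB b x].
Proof.
move=> /action_morphism [f fE] /action_morphism [g gE].
have [h [hf hg] _] := hG f g.
exists (fun u => bij_fun (h u)); split => [|a x|b x].
- split => [x|u v x]; last by rewrite gmulfM.
  by rewrite group_morph1.
- by rewrite -fE -hf.
- by rewrite -gE -hg.
Qed.

(** [A] and [B] generate [G]. The [k] whose translation preserves [P] form a subgroup
    [K] containing both factors; the universal property yields a retraction of [G]
    into [K], which by uniqueness is the identity of [G]. *)
Lemma free_product_ind (P : G -> Prop) :
  P 1 -> (forall a g, P g -> P (iA a * g)) -> (forall b g, P g -> P (iB b * g)) ->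
  forall g, P g.
Proof.
move=> P1 PA PB.
pose K : {pred G} := fun k => `[< forall g, P (k * g) <-> P g >].
have KP k : reflect (forall g, P (k * g) <-> P g) (k \in K) by apply: asboolP.
have K_closed : group_closed K.
  split=> [|k l /KP kK /KP lK]; first by apply/KP => g; rewrite mul1g.
  by apply/KP => g; rewrite -mulgA kK -{2}(mulVKg l g) lK.
have KA a : iA a \in K.
  by apply/KP=> g; split=> [/(PA a^-1)|/PA//];
    rewrite mulgA -gmulfM mulVg group_morph1 mul1g.
have KB b : iB b \in K.
  by apply/KP=> g; split=> [/(PB b^-1)|/PB//];
    rewrite mulgA -gmulfM mulVg group_morph1 mul1g.
pose H : groupType := HB.pack {k : G | k \in K}
  (SubChoice_isSubGroup.Build G (fun k => k \in K) {k : G | k \in K} K_closed).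
pose fA a : H := exist _ (iA a) (KA a).
pose fB b : H := exist _ (iB b) (KB b).
have fAM : {morph fA : x y / x * y} by move=> x y; apply/val_inj; rewrite /= gmulfM.
have fBM : {morph fB : x y / x * y} by move=> x y; apply/val_inj; rewrite /= gmulfM.
pose FA : {multiplicative A -> H} := HB.pack fA (isMultiplicative.Build A H fA fAM).
pose FB : {multiplicative B -> H} := HB.pack fB (isMultiplicative.Build B H fB fBM).
have [h [hA hB] _] := hG FA FB.
have [i _ i_uniq] := hG iA iB.
pose r (g : G) : G := val (h g).
have rM : {morph r : x y / x * y} by move=> x y; rewrite /r gmulfM.
pose F : {multiplicative G -> G} := HB.pack r (isMultiplicative.Build G G r rM).
have F_id g : F g = g.
  rewrite (i_uniq F); last first.
    by split => x; [have := congr1 val (hA x) | have := congr1 val (hB x)].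
  exact/esym/(i_uniq idfun).
move=> g; rewrite -[g]F_id -[F g]mulg1.
by have /KP -> := valP (h g).
Qed.
End FreeProduct.

(** * Syllables *)

Section ReducedWords.
Variables A B : groupType.
Implicit Types (w : seq (A + B)).

Definition headA w : A := if w is inl a :: _ then a else 1.
Definition headB w : B := if w is inr b :: _ then b else 1.
Definition dropA w := if w is inl _ :: w' then w' else w.
Definition dropB w := if w is inr _ :: w' then w' else w.

Fixpoint reduced w : bool :=
  match w with
  | [::] => true
  | inl a :: w' => [&& a != 1, headA w' == 1 & reduced w']
  | inr b :: w' => [&& b != 1, headB w' == 1 & reduced w']
  end.

Definition consA (a : A) w := if a == 1 then w else inl a :: w.
Definition consB (b : B) w := if b == 1 then w else inr b :: w.

(** Nonreduced words are left fixed, so that [A] acts on the whole type of words. *)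
Definition actA a w := if reduced w then consA (a * headA w) (dropA w) else w.
Definition actB b w := if reduced w then consB (b * headB w) (dropB w) else w.

Lemma headA_dropA w : reduced w -> headA (dropA w) = 1.
Proof. by case: w => [|[a|b] w] //= /and3P [_ /eqP]. Qed.
Lemma headB_dropB w : reduced w -> headB (dropB w) = 1.
Proof. by case: w => [|[a|b] w] //= /and3P [_ /eqP]. Qed.

Lemma reduced_dropA w : reduced w -> reduced (dropA w).
Proof. by case: w => [|[a|b] w] //= /and3P []. Qed.
Lemma reduced_dropB w : reduced w -> reduced (dropB w).
Proof. by case: w => [|[a|b] w] //= /and3P []. Qed.

Lemma consA_headA w : reduced w -> consA (headA w) (dropA w) = w.
Proof.
by rewrite /consA; case: w => [|[a|b] w] /=; rewrite ?eqxx // => /andP [/negPf->].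
Qed.
Lemma consB_headB w : reduced w -> consB (headB w) (dropB w) = w.
Proof.
by rewrite /consB; case: w => [|[a|b] w] /=; rewrite ?eqxx // => /andP [/negPf->].
Qed.

Lemma reduced_consA a w : reduced w -> headA w = 1 -> reduced (consA a w).
Proof. by rewrite /consA => rw hw; case: eqP => //= /eqP ->; rewrite hw eqxx. Qed.
Lemma reduced_consB b w : reduced w -> headB w = 1 -> reduced (consB b w).
Proof. by rewrite /consB => rw hw; case: eqP => //= /eqP ->; rewrite hw eqxx. Qed.

Lemma reduced_headA w : reduced w -> headA w = 1 -> dropA w = w.
Proof. by case: w => [|[a|b] w] //= /and3P [/eqP]. Qed.
Lemma reduced_headB w : reduced w -> headB w = 1 -> dropB w = w.
Proof. by case: w => [|[a|b] w] //= /and3P [/eqP]. Qed.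

Lemma headA_consA a w : headA w = 1 -> headA (consA a w) = a.
Proof. by rewrite /consA; case: eqP => [->|]. Qed.
Lemma headB_consB b w : headB w = 1 -> headB (consB b w) = b.
Proof. by rewrite /consB; case: eqP => [->|]. Qed.

Lemma dropA_consA a w : reduced w -> headA w = 1 -> dropA (consA a w) = w.
Proof. by rewrite /consA; case: eqP => //= _; apply: reduced_headA. Qed.
Lemma dropB_consB b w : reduced w -> headB w = 1 -> dropB (consB b w) = w.
Proof. by rewrite /consB; case: eqP => //= _; apply: reduced_headB. Qed.

Lemma reduced_actA a w : reduced (actA a w) = reduced w.
Proof.
rewrite /actA; case: ifP => [rw|->//].
by rewrite reduced_consA ?reduced_dropA ?headA_dropA.
Qed.
Lemma reduced_actB b w : reduced (actB b w) = reduced w.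
Proof.
rewrite /actB; case: ifP => [rw|->//].
by rewrite reduced_consB ?reduced_dropB ?headB_dropB.
Qed.

Lemma actA_action : left_action actA.
Proof.
split=> [w|a b w]; rewrite /actA.
  by rewrite mul1g; case: ifP => // /consA_headA.
case: (boolP (reduced w)) => [rw|/negPf->//].
rewrite reduced_consA ?reduced_dropA ?headA_dropA //.
by rewrite headA_consA ?dropA_consA ?reduced_dropA ?headA_dropA // mulgA.
Qed.

Lemma actB_action : left_action actB.
Proof.
split=> [w|a b w]; rewrite /actB.
  by rewrite mul1g; case: ifP => // /consB_headB.
case: (boolP (reduced w)) => [rw|/negPf->//].
rewrite reduced_consB ?reduced_dropB ?headB_dropB //.
by rewrite headB_consB ?dropB_consB ?reduced_dropB ?headB_dropB // mulgA.
Qed.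

End ReducedWords.

(** The properties of normal forms used below: [pA g] is the first syllable of [g] if
    it lies in [A] and [1] otherwise, [pB] likewise, and [len] is the number of
    syllables. *)
Record syllables (A B G : groupType) (iA : A -> G) (iB : B -> G)
    (pA : G -> A) (pB : G -> B) (len : G -> nat) : Prop := Syllables {
  syllA1 : pA 1 = 1;
  syllB1 : pB 1 = 1;
  syllA : forall a g, pA (iA a * g) = a * pA g;
  syllB : forall b g, pB (iB b * g) = b * pB g;
  syllAB : forall g, pA g <> 1 -> pB g = 1;
  syll1 : forall g, pA g = 1 -> pB g = 1 -> g = 1;
  sylllenA : forall g, pA g <> 1 -> (len ((iA (pA g))^-1 * g)%g < len g)%N;
  sylllenB : forall g, pB g <> 1 -> (len ((iB (pB g))^-1 * g)%g < len g)%N }.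

Lemma syllables_swap (A B G : groupType) (iA : A -> G) (iB : B -> G) pA pB len :
  syllables iA iB pA pB len -> syllables iB iA pB pA len.
Proof.
case=> A1 B1 Am Bm AB p1 lA lB; split=> // [g nB|g B1' A1']; last exact: p1.
by have [//|/eqP/AB] := eqVneq (pA g) 1.
Qed.

(** Van der Waerden's trick: the normal form of [g] is the image of the empty word
    under the action of [g] on words. It determines [g], since evaluating words
    commutes with the action. *)
Lemma free_product_syllables (A B G : groupType)
    (iA : {multiplicative A -> G}) (iB : {multiplicative B -> G}) :
  is_free_product iA iB -> exists pA pB len, syllables iA iB pA pB len.
Proof.
move=> hG.
have [act [[act1 actM] aA aB]] :=
  free_product_action hG (actA_action A B) (actB_action A B).
pose w g := act g [::].
have wA a g : w (iA a * g) = actA a (w g) by rewrite /w actM aA.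
have wB b g : w (iB b * g) = actB b (w g) by rewrite /w actM aB.
have rw g : reduced (w g).
  by elim/(free_product_ind hG): g => [|a g|b g]; rewrite ?wA ?wB ?reduced_actA
    ?reduced_actB // /w act1.
pose letter (x : A + B) := match x with inl a => iA a | inr b => iB b end.
pose ev (s : seq (A + B)) := foldr (fun x g => letter x * g) 1 s.
have ev_consA a s : ev (consA a s) = iA a * ev s.
  by rewrite /consA; case: eqP => [->|//]; rewrite group_morph1 mul1g.
have evA a s : reduced s -> ev (actA a s) = iA a * ev s.
  move=> rs; rewrite /actA rs -[in RHS](consA_headA rs) !ev_consA.
  by rewrite gmulfM mulgA.
have ev_consB b s : ev (consB b s) = iB b * ev s.
  by rewrite /consB; case: eqP => [->|//]; rewrite group_morph1 mul1g.
have evB b s : reduced s -> ev (actB b s) = iB b * ev s.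
  move=> rs; rewrite /actB rs -[in RHS](consB_headB rs) !ev_consB.
  by rewrite gmulfM mulgA.
have evK g : ev (w g) = g.
  elim/(free_product_ind hG): g => [|a g IH|b g IH]; first by rewrite /w act1.
    by rewrite wA evA ?IH.
  by rewrite wB evB ?IH.
exists (fun g => headA (w g)), (fun g => headB (w g)), (fun g => size (w g)).
split.
- by rewrite /w act1.
- by rewrite /w act1.
- by move=> a g; rewrite wA /actA rw headA_consA ?headA_dropA.
- by move=> b g; rewrite wB /actB rw headB_consB ?headB_dropB.
- by move=> g; case: (w g) => [|[a|b] s].
- move=> g; rewrite -[in g = 1](evK g).
  by case: (w g) (rw g) => [|[a|b] s] //= /and3P [/eqP ? _ _].
- move=> g; rewrite -group_morphV wA /actA rw mulVg /consA eqxx.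
  by case: (w g) => [|[a|b] s].
- move=> g; rewrite -group_morphV wB /actB rw mulVg /consB eqxx.
  by case: (w g) => [|[a|b] s].
Qed.

Section Syllables.
Variables (A B G : groupType).
Variables (iA : {multiplicative A -> G}) (iB : {multiplicative B -> G}).
Variables (pA : G -> A) (pB : G -> B) (len : G -> nat).
Hypothesis nf : syllables iA iB pA pB len.

Lemma syllable_ind (P : G -> Prop) :
  P 1 ->
  (forall a g, a <> 1 -> pA g = 1 -> P g -> P (iA a * g)) ->
  (forall b g, b <> 1 -> pB g = 1 -> P g -> P (iB b * g)) ->
  forall g, P g.
Proof.
move=> P1 PA PB g; have [n] := ubnP (len g); elim: n g => // n IH g; rewrite ltnS => le.
have [eA|/eqP nA] := eqVneq (pA g) 1; last first.
  rewrite -[g](mulVKg (iA (pA g))); apply: PA => //.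
    by rewrite -group_morphV (syllA nf) mulVg.
  exact: IH (leq_trans (sylllenA nf nA) le).
have [eB|/eqP nB] := eqVneq (pB g) 1; first by rewrite (syll1 nf eA eB).
rewrite -[g](mulVKg (iB (pB g))); apply: PB => //.
  by rewrite -group_morphV (syllB nf) mulVg.
exact: IH (leq_trans (sylllenB nf nB) le).
Qed.

Lemma syllA_iA a : pA (iA a) = a.
Proof. by rewrite -[iA a]mulg1 (syllA nf) (syllA1 nf) mulg1. Qed.

Lemma syllB_iA a : pB (iA a) = 1.
Proof.
have [->|/eqP na] := eqVneq a 1; first by rewrite group_morph1 (syllB1 nf).
by apply: (syllAB nf); rewrite syllA_iA.
Qed.

Lemma syllA_cons a g : pA g = 1 -> pA (iA a * g) = a.
Proof. by move=> g1; rewrite (syllA nf) g1 mulg1. Qed.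

Lemma syllB_consA a g : a <> 1 -> pA g = 1 -> pB (iA a * g) = 1.
Proof. by move=> a1 g1; apply: (syllAB nf); rewrite syllA_cons. Qed.
End Syllables.

(** Right multiplication by one syllable only touches the end of the normal form, so
    it can alter the projection to [A] only at the points of [A]. *)
Definition right_stable (A B G : groupType) (iA : A -> G) (iB : B -> G)
    (pA : G -> A) (g : G) : Prop :=
  (forall b, pA (g * iB b) = pA g) /\
  (forall a, pA (g * iA a) = pA g \/ g = iA (pA g)).

(** Both conclusions rest on the stability of [pA] alone: unless [g = 1], the product
    [iA c * g] still begins with [c] after one syllable is appended. *)
Lemma right_stable_cons (A B G : groupType)
    (iA : {multiplicative A -> G}) (iB : {multiplicative B -> G})
    (pA : G -> A) (pB : G -> B) (len : G -> nat) (c : A) (g : G) :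
  syllables iA iB pA pB len -> c <> 1 -> pA g = 1 ->
  right_stable iA iB pA g ->
  right_stable iA iB pA (iA c * g) /\ right_stable iB iA pB (iA c * g).
Proof.
move=> nf nc g1 [gB gA].
have g1' : g = iA (pA g) -> g = 1 by rewrite g1 group_morph1.
split; split=> [b|a].
- by rewrite -mulgA !(syllA nf) gB.
- rewrite -mulgA !(syllA nf) g1 mulg1.
  by case: (gA a) => [->|/g1' ->]; [left; rewrite g1 mulg1 | right; rewrite mulg1].
- rewrite (syllB_consA nf) // -mulgA.
  case: (gA b) => [e|/g1' ->]; first by rewrite (syllB_consA nf) // e.
  by rewrite mul1g -gmulfM (syllB_iA nf).
- left; rewrite (syllB_consA nf) // -mulgA (syllB_consA nf) //.
  by rewrite gB.
Qed.

Lemma syllables_right_stable (A B G : groupType)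
    (iA : {multiplicative A -> G}) (iB : {multiplicative B -> G})
    (pA : G -> A) (pB : G -> B) (len : G -> nat) (g : G) :
  syllables iA iB pA pB len -> right_stable iA iB pA g.
Proof.
move=> nf; have nf' := syllables_swap nf.
suff [] : right_stable iA iB pA g /\ right_stable iB iA pB g by [].
elim/(syllable_ind nf): g => [|a g na g1 [sA sB]|b g nb g1 [sA sB]].
- by split; split=> x; rewrite ?mul1g ?(syllA1 nf) ?(syllB1 nf) ?(syllB_iA nf)
    ?(syllB_iA nf') //; right; rewrite group_morph1.
- exact: (right_stable_cons nf).
- by have [] := right_stable_cons nf' nb g1 sB.
Qed.

(** * The word norm and the growth function *)

Section WordNorm.
Variables (G : groupType) (S : {fset G}).
Hypothesis hS : generates S.
Implicit Types (g h : G) (w : seq G).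

Definition word_val w : G := \prod_(x <- w) x.

Lemma word_val_nil : word_val [::] = 1. Proof. exact: big_nil. Qed.
Lemma word_val_cons x w : word_val (x :: w) = x * word_val w.
Proof. exact: big_cons. Qed.
Lemma word_val_cat v w : word_val (v ++ w) = word_val v * word_val w.
Proof. exact: big_cat. Qed.

Definition wnorm g : nat := word_dist S 1 g.

Lemma is_word_cat w w' : is_word S (w ++ w') = is_word S w && is_word S w'.
Proof. exact: all_cat. Qed.

Lemma is_word_cons x w :
  is_word S (x :: w) = ((x \in S) || (x^-1 \in S)) && is_word S w.
Proof. by []. Qed.

Lemma wnorm_spec g :
  (exists w, [/\ is_word S w, size w = wnorm g & word_val w = g]) /\
  (forall w, is_word S w -> word_val w = g -> (wnorm g <= size w)%N).
Proof.
rewrite /wnorm /word_dist; case: pselect => [ex|nex]; last first.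
  have [w ww wg] := hS g; case: nex; exists (size w).
  by apply/asboolP; exists w; split; rewrite ?invg1 ?mul1g.
case: ex_minnP => n /asboolP [w [ww <- wg]] n_min; rewrite invg1 mul1g in wg.
split; first by exists w.
move=> v wv vg; apply: n_min; apply/asboolP; exists v.
by rewrite invg1 mul1g.
Qed.

Lemma geodesic g :
  exists w, [/\ is_word S w, size w = wnorm g & word_val w = g].
Proof. by case: (wnorm_spec g). Qed.

Lemma wnorm_word_val w : is_word S w -> (wnorm (word_val w) <= size w)%N.
Proof. by move=> ww; case: (wnorm_spec (word_val w)) => _; apply. Qed.

Lemma wnorm1 : wnorm 1 = 0%N.
Proof. by apply/eqP; rewrite -leqn0 -word_val_nil (wnorm_word_val (w := [::])). Qed.

Lemma wnormM g h : (wnorm (g * h) <= wnorm g + wnorm h)%N.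
Proof.
have [[v [wv <- <-]] [w [ww <- <-]]] := (geodesic g, geodesic h).
by rewrite -size_cat -word_val_cat wnorm_word_val // is_word_cat wv.
Qed.

Lemma wnormM3 g h k i j l : (wnorm g <= i)%N -> (wnorm h <= j)%N ->
  (wnorm k <= l)%N -> (wnorm (g * h * k) <= i + j + l)%N.
Proof.
move=> gi hj kl; apply: leq_trans (wnormM _ _) _; apply: leq_add kl.
by apply: leq_trans (wnormM _ _) _; apply: leq_add.
Qed.

Lemma is_word_inv w :
  is_word S w -> is_word S [seq x^-1 | x <- rev w].
Proof.
rewrite /is_word all_map all_rev; apply: sub_all => x /=.
by rewrite invgK orbC.
Qed.

Lemma word_val_inv w : word_val [seq x^-1 | x <- rev w] = (word_val w)^-1.
Proof.
elim: w => [|x w IH]; first by rewrite !word_val_nil invg1.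
rewrite rev_cons map_rcons -cats1 word_val_cat IH !word_val_cons word_val_nil.
by rewrite mulg1 invgM.
Qed.

Lemma wnormV g : wnorm g^-1 = wnorm g.
Proof.
suff le h : (wnorm h^-1 <= wnorm h)%N.
  by apply/eqP; rewrite eqn_leq le -{1}[g]invgK le.
have [w [ww <- <-]] := geodesic h.
by rewrite -word_val_inv -(size_rev w) -(size_map invg) wnorm_word_val ?is_word_inv.
Qed.

Lemma wnorm_sub g h : (wnorm g <= wnorm (g * h) + wnorm h)%N.
Proof. by rewrite -{1}[g](mulgK h) -(wnormV h) wnormM. Qed.

Definition letters : seq G := enum_fset S ++ [seq x^-1 | x <- enum_fset S].

Lemma mem_letters x : (x \in letters) = (x \in S) || (x^-1 \in S).
Proof.
rewrite mem_cat; congr (_ || _); apply/mapP/idP => [[y yS ->]|xS].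
  by rewrite invgK.
by exists x^-1; rewrite ?invgK.
Qed.

Definition words_of_size n : seq G :=
  iter n (fun s => [seq x * g | x <- letters, g <- s]) [:: 1].

Lemma mem_words_of_size n g :
  reflect (exists w, [/\ is_word S w, size w = n & word_val w = g])
          (g \in words_of_size n).
Proof.
elim: n g => [|n IH] g.
  rewrite inE; apply: (iffP eqP) => [->|[w [_ /size0nil -> <-]]];
    last by rewrite word_val_nil.
  by exists [::]; rewrite word_val_nil.
rewrite [words_of_size _]iterS -/(words_of_size n).
apply: (iffP allpairsP) => [[[x h] /= [xl /IH [w [ww <- <-]] ->]]|].
  by exists (x :: w); rewrite is_word_cons /= word_val_cons -mem_letters xl.
move=> [[|x w] [] // /[!is_word_cons] /andP [xS ww] [sw] <-].
exists (x, word_val w); rewrite /= word_val_cons mem_letters.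
by split=> //; apply/IH; exists w.
Qed.

(** Balls are sequences without repetition, so that cardinals are sizes and counting
    arguments reduce to inclusions of sequences. *)
Definition wball n : seq G := undup (flatten [seq words_of_size k | k <- iota 0 n.+1]).

Lemma uniq_wball n : uniq (wball n). Proof. exact: undup_uniq. Qed.

Lemma mem_wball n g : (g \in wball n) = (wnorm g <= n)%N.
Proof.
rewrite mem_undup; apply/flatten_mapP/idP => [[k]|gn].
  rewrite mem_iota add0n ltnS => /= kn /mem_words_of_size [w [ww sw <-]].
  by apply: leq_trans kn; rewrite -sw wnorm_word_val.
exists (wnorm g); first by rewrite mem_iota.
exact/mem_words_of_size/geodesic.
Qed.

Definition growth n : nat := size (wball n).

Lemma size_le_growth (s : seq G) n :
  uniq s -> (forall g, g \in s -> (wnorm g <= n)%N) -> (size s <= growth n)%N.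
Proof. by move=> us sn; apply: uniq_leq_size => // g /sn; rewrite mem_wball. Qed.

Lemma growth_gt0 n : (0 < growth n)%N.
Proof.
by apply: (@size_le_growth [:: 1]) => // g; rewrite inE => /eqP->; rewrite wnorm1.
Qed.

Lemma growthD m n : (growth (m + n) <= growth m * growth n)%N.
Proof.
rewrite /growth -(size_allpairs *%g).
apply: uniq_leq_size; first exact: uniq_wball.
move=> g; rewrite mem_wball; have [w [ww <- <-]] := geodesic g.
rewrite -{2}(cat_take_drop m w) word_val_cat => wmn.
move: ww; rewrite -{1}(cat_take_drop m w) is_word_cat => /andP [w1 w2].
apply: allpairs_f; rewrite mem_wball.
  by apply: leq_trans (wnorm_word_val w1) _; rewrite size_take; case: ltnP.
by apply: leq_trans (wnorm_word_val w2) _; rewrite size_drop leq_subLR.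
Qed.

(** Enlarging the radius by [n] costs at most an exponential factor in [n]: the
    price of an insertion. *)
Lemma growthDn m n : (growth (m + n) <= growth m * growth 1 ^ n)%N.
Proof.
elim: n => [|n IH]; first by rewrite addn0 muln1.
rewrite addnS -addn1 expnSr mulnA.
by apply: leq_trans (growthD _ _) _; rewrite leq_mul2r IH orbT.
Qed.

End WordNorm.

(** * The projection to a factor and geodesics *)

Section Projection.
Variables (A B G : groupType) (S : {fset G}).
Variables (iA : {multiplicative A -> G}) (iB : {multiplicative B -> G}).
Variables (pA : G -> A) (pB : G -> B) (len : G -> nat).
Hypothesis hS : generates S.
Hypothesis nf : syllables iA iB pA pB len.
Local Notation norm := (wnorm S).

(** The fibre of the projection over a point of [A] can be left only near that point:
    this is the bottleneck of the tree of cosets. *)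
Definition bottleneck (D : nat) : Prop :=
  forall s u, s \in letters S -> pA (u * s) <> pA u ->
    (norm ((iA (pA u))^-1 * u)%g <= D)%N.

(** Write a generator as a product of syllables. If the projection changes, it does so
    at one of the syllables, hence at a point of [A], which is then [iA (pA u)]; the
    norms of the syllables before it bound its distance from [u]. *)
Lemma bottleneck_exists : exists D, bottleneck D.
Proof.
have one s : exists D, forall u, pA (u * s) <> pA u ->
    (norm ((iA (pA u))^-1 * u)%g <= D)%N.
  have step t g D : (forall u, pA (u * g) <> pA u ->
        (norm ((iA (pA u))^-1 * u)%g <= D)%N) ->
      (forall u, pA (u * t) = pA u \/ u = iA (pA u)) ->
      exists D', forall u, pA (u * (t * g)) <> pA u ->
        (norm ((iA (pA u))^-1 * u)%g <= D')%N.
    move=> gD tD; exists (D + norm t)%N => u; rewrite mulgA.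
    case: (tD u) => [tu|eu _]; last by rewrite {2}eu mulVg wnorm1.
    rewrite -{1}tu => /gD; rewrite tu mulgA => le.
    by apply: leq_trans (wnorm_sub hS _ t) _; rewrite leq_add2r.
  elim/(syllable_ind nf): s => [|a g _ _ [D gD]|b g _ _ [D gD]].
  - by exists 0%N => u; rewrite mulg1.
  - by apply: step gD _ => u; case: (syllables_right_stable u nf) => _; apply.
  - by apply: step gD _ => u; case: (syllables_right_stable u nf) => sB _; left.
(* There are finitely many generators, so the bounds have a maximum. *)
suff [D HD] : exists D, forall s, s \in letters S -> forall u, pA (u * s) <> pA u ->
    (norm ((iA (pA u))^-1 * u)%g <= D)%N by exists D => s u /HD; apply.
elim: (letters S) => [|s l [D HD]]; first by exists 0%N.
have [D' HD'] := one s; exists (maxn D D') => t; rewrite inE.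
by by case/orP => [/eqP -> u /HD'|/HD tD u /tD] le; rewrite leq_max le ?orbT.
Qed.

Variable D : nat.
Hypothesis projD : bottleneck D.

(** The vertex where the projection is about to leave its initial value is near that
    value, and so is a final vertex lying on [A] over it. *)
Lemma first_change w v : is_word S w ->
  pA (v * word_val w) <> pA v \/ v * word_val w = iA (pA v) ->
  exists w1 w2, [/\ w = w1 ++ w2, is_word S w1, is_word S w2,
    pA (v * word_val w1) = pA v & (norm ((iA (pA v))^-1 * (v * word_val w1))%g <= D)%N].
Proof.
move=> + [+|e]; last first.
  by exists w, [::]; split=> //; rewrite ?cats0 // e ?(syllA_iA nf) // mulVg wnorm1.
elim: w v => [|x w IH] v; first by rewrite word_val_nil mulg1.
rewrite is_word_cons word_val_cons mulgA => /andP [xS ww].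
have [e|/eqP ne] := eqVneq (pA (v * x)) (pA v); last first.
  move=> _; exists [::], (x :: w); rewrite is_word_cons word_val_nil mulg1 xS; split=> //.
  by apply: projD ne; rewrite mem_letters.
rewrite -{1}e => /(IH _ ww) [w1 [w2 [-> ww1 ww2 p1 le]]].
by exists (x :: w1), w2; rewrite is_word_cons xS ww1 ww2 word_val_cons mulgA -e p1.
Qed.

(** Seen from [x], that is after translation by [x^-1], the path goes from a point
    projecting to [1] to a point projecting to [a]. The first change of projection
    takes place near [x]; the first change along the reversed path takes place near
    [x * iA a]. The three pieces between these points bound the three norms. *)
Lemma passes_near x a y w :
  pA x^-1 = 1 -> pA y = 1 -> a <> 1 -> is_word S w ->
  word_val w = x * iA a * y ->
  (exists w1 w2, w = w1 ++ w2 /\ (norm (x^-1 * word_val w1)%g <= D)%N) /\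
  (norm x + norm (iA a) + norm y <= size w + 4 * D)%N.
Proof.
move=> x1 y1 na ww we.
have e1 : x^-1 * word_val w = iA a * y by rewrite we !mulgA mulVg mul1g.
have [|w1 [w2 [ew ww1 ww2 pp1]]] := @first_change w x^-1 ww.
  by left; rewrite e1 x1 (syllA_cons nf).
rewrite x1 in pp1 *; rewrite group_morph1 invg1 mul1g => le1.
split; first by exists w1, w2.
set p := x^-1 * _ in le1 pp1.
have pw2 : p * word_val w2 = iA a * y.
  by rewrite -e1 ew word_val_cat /p mulgA.
have [|w3 [w4 [ew3 ww3 ww4 _]]] := @first_change _ (iA a * y) (is_word_inv ww2).
  left; rewrite word_val_inv -pw2 mulgK pw2 (syllA_cons nf) // => pa.
  by apply: na; rewrite -pa pp1.
rewrite (syllA_cons nf) // -!mulgA mulKg; set q := y * _ => le2.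
have le_x : (norm x <= size w1 + D)%N.
  rewrite -(wnormV hS); have := wnorm_sub hS x^-1 (word_val w1).
  have := wnorm_word_val hS ww1; rewrite -/p; move: le1; lia.
have le_y : (norm y <= size w3 + D)%N.
  have := wnorm_sub hS y (word_val w3).
  have := wnorm_word_val hS ww3; rewrite -/q; move: le2; lia.
have ea : iA a = p * (word_val w4)^-1 * q^-1.
  apply: (mulIg q); rewrite mulgVK; apply: (mulIg (word_val w4)).
  rewrite mulgVK /q !mulgA -pw2 -mulgA -word_val_cat -ew3 word_val_inv.
  by rewrite mulgK.
have le_a : (norm (iA a) <= size w4 + 2 * D)%N.
  rewrite ea; apply: leq_trans (wnormM3 hS le1 (j := size w4) (l := D) _ _) _.
  - by rewrite (wnormV hS) wnorm_word_val.
  - by rewrite (wnormV hS).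
  - lia.
have : size w2 = (size w3 + size w4)%N.
  by rewrite -size_cat -ew3 size_map size_rev.
have := congr1 size ew; rewrite size_cat; move: le_x le_y le_a; lia.
Qed.

(** From a vertex [p] of the geodesic follow it in both directions until a change of
    projection. Both stopping points are within [D] of [iA (pA p)], hence within
    [2 D] of each other; the word being geodesic, they are also within [2 D] of [p]. *)
Lemma geodesic_near a w i :
  is_word S w -> size w = norm (iA a) -> word_val w = iA a ->
  (norm ((iA (pA (word_val (take i w))))^-1 * word_val (take i w))%g <= 3 * D)%N.
Proof.
move=> ww sw we; set p := word_val (take i w).
have ew : w = take i w ++ drop i w by rewrite cat_take_drop.
have /andP [wt wd] : is_word S (take i w) && is_word S (drop i w).
  by rewrite -is_word_cat -ew.
have [|w3 [w4 [ew3 ww3 ww4 _ le3]]] := @first_change _ p (is_word_inv wt).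
  rewrite word_val_inv mulgV (syllA1 nf).
  by have [->|/eqP] := eqVneq (pA p) 1; [right; rewrite group_morph1 | left; apply: nesym].
have pd : p * word_val (drop i w) = iA a by rewrite -we {2}ew word_val_cat.
have [|w5 [w6 [ew5 ww5 ww6 _ le5]]] := @first_change _ p wd.
  rewrite pd (syllA_iA nf).
  by have [->|/eqP] := eqVneq (pA p) a; [right | left; apply: nesym].
set P := word_val w3 in le3; set Q := word_val w5 in le5.
have PQ : (norm (P^-1 * Q)%g <= D + D)%N.
  have -> : P^-1 * Q = ((iA (pA p))^-1 * (p * P))^-1 * ((iA (pA p))^-1 * (p * Q)).
    by rewrite !invgM invgK -!mulgA mulVKg mulKg.
  by apply: leq_trans (wnormM hS _ _) _; rewrite (wnormV hS) leq_add.
have s3 : (size w3 <= D + D)%N.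
  (* Otherwise replacing the piece from [p * P] to [p * Q] would shorten the word. *)
  have e4 : p = (word_val w4)^-1 * P^-1.
    by rewrite -invgM -word_val_cat -ew3 word_val_inv invgK.
  have : (size w <= size w4 + (D + D) + size w6)%N.
    rewrite sw -pd ew5 word_val_cat e4 -/Q.
    rewrite [X in norm X](_ : _ =
      (word_val w4)^-1 * (P^-1 * Q) * word_val w6); last by rewrite !mulgA.
    apply: wnormM3 => //; last exact: wnorm_word_val.
    by rewrite (wnormV hS) wnorm_word_val.
  have := congr1 size ew3; rewrite size_map size_rev size_cat.
  have := congr1 size ew5; have := congr1 size ew; rewrite !size_cat.
  by move=> -> -> ->; lia.
apply: leq_trans (wnorm_sub hS _ P) _; rewrite -mulgA.
have le_P := leq_trans (wnorm_word_val hS ww3) s3.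
by apply: leq_trans (leq_add le3 le_P) _; lia.
Qed.

(** The projections of the vertices of a geodesic from [1] to [iA a] form a
    quasigeodesic inside [A] that joins [1] to [a] at unit speed, up to an additive error. *)
Lemma milestones_exist a : exists q : nat -> A,
  [/\ q 0%N = 1, q (norm (iA a)) = a &
  forall i j, (i <= j <= norm (iA a))%N ->
    (norm (iA ((q i)^-1 * q j)%g) <= j - i + 6 * D)%N /\
    (j - i <= norm (iA ((q i)^-1 * q j)%g) + 6 * D)%N].
Proof.
have [w [ww sw we]] := geodesic hS (iA a).
pose p i := word_val (take i w).
have near i : (norm ((iA (pA (p i)))^-1 * p i)%g <= 3 * D)%N.
  exact: (geodesic_near i ww sw we).
exists (fun i => pA (p i)); split.
- by rewrite /p take0 word_val_nil (syllA1 nf).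
- by rewrite /p -sw take_size we (syllA_iA nf).
move=> i j /andP [ij jm].
have pij : norm ((p i)^-1 * p j)%g = (j - i)%N.
  have ej : take j w = take i w ++ take (j - i) (drop i w).
    by rewrite take_drop subnK // -{1}(cat_take_drop i (take j w)) take_takel.
  have ew : w = take i w ++ take (j - i) (drop i w) ++ drop j w.
    by rewrite catA -ej cat_take_drop.
  have /andP [w1 /andP [w2 w3]] : is_word S (take i w) &&
      (is_word S (take (j - i) (drop i w)) && is_word S (drop j w)).
    by rewrite -!is_word_cat -ew.
  have e : (p i)^-1 * p j = word_val (take (j - i) (drop i w)).
    by rewrite /p ej word_val_cat mulKg.
  apply/eqP; rewrite eqn_leq; apply/andP; split.
    by rewrite e; apply: leq_trans (wnorm_word_val hS w2) _; rewrite size_take; case: ltnP.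
  have : (norm (iA a) <= i + norm ((p i)^-1 * p j)%g + (size w - j))%N.
    rewrite -we {1}ew !word_val_cat -e mulgA.
    apply: leq_trans (wnormM hS _ _) _; apply: leq_add; last first.
      by rewrite -size_drop wnorm_word_val.
    apply: leq_trans (wnormM hS _ _) _; rewrite leq_add2r.
    by apply: leq_trans (wnorm_word_val hS w1) _; rewrite size_take; case: ltnP => // /ltnW.
  lia.
have ni := near i; have nj := near j.
set qi := pA (p i) in ni *; set qj := pA (p j) in nj *.
have e1 : iA (qi^-1 * qj) = ((iA qi)^-1 * p i) * ((p i)^-1 * p j) * ((iA qj)^-1 * p j)^-1.
  by rewrite gmulfM group_morphV invgM invgK !mulgA mulgK mulgK.
have e2 : (p i)^-1 * p j = ((iA qi)^-1 * p i)^-1 * iA (qi^-1 * qj) * ((iA qj)^-1 * p j).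
  by rewrite gmulfM group_morphV invgM invgK !mulgA mulgK mulgK.
split.
  rewrite e1; apply: leq_trans (wnormM3 hS ni (eq_leq pij) (l := 3 * D) _) _.
    by rewrite (wnormV hS).
  lia.
rewrite -pij {1}e2.
apply: leq_trans (wnormM3 hS (i := 3 * D) _ (leqnn _) nj) _; last by lia.
by rewrite (wnormV hS).
Qed.
End Projection.

(** * Insertions into an elliptic element *)

(** Counts the pairs [(g, u)] with [u] in [I g]; [F] bounds the fibres. *)
Lemma double_count (T U : eqType) (E : seq T) (V : seq U)
    (I : T -> seq U) (F : U -> seq T) (c f : nat) :
  uniq E -> (forall g, g \in E -> uniq (I g)) ->
  (forall g, g \in E -> c <= size (I g))%N ->
  (forall g u, g \in E -> u \in I g -> u \in V /\ g \in F u) ->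
  (forall u, size (F u) <= f)%N ->
  (size E * c <= size V * f)%N.
Proof.
move=> uE uI cI IV Ff.
pose lhs := [seq (g, u) | g <- E, u <- I g].
pose rhs := [seq (g, u) | u <- V, g <- F u].
have le1 : (size E * c <= size lhs)%N.
  rewrite /lhs size_allpairs_dep -sum1_size big_distrl /= sumnE big_map.
  rewrite big_seq [X in (_ <= X)%N]big_seq; apply: leq_sum => g gE.
  by rewrite mul1n cI.
have le2 : (size rhs <= size V * f)%N.
  rewrite /rhs size_allpairs_dep -[size V]sum1_size big_distrl /= sumnE big_map.
  by apply: leq_sum => u _; rewrite mul1n.
apply: leq_trans le1 _; apply: leq_trans le2; apply: uniq_leq_size.
  apply: allpairs_uniq_dep => //.
  by move=> [g u] [g' u'] _ _ /= [-> ->].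
move=> _ /allpairsPdep [g [u [gE uI' ->]]].
have [uV gF] := IV _ _ gE uI'.
by apply/allpairsPdep; exists u, g.
Qed.

Section Insertion.
Variables (A B G : groupType) (S : {fset G}).
Variables (iA : {multiplicative A -> G}) (iB : {multiplicative B -> G}).
Variables (pA : G -> A) (pB : G -> B) (len : G -> nat).
Hypothesis hS : generates S.
Hypothesis nf : syllables iA iB pA pB len.
Local Notation norm := (wnorm S).

Variables (t : B) (ht : t <> 1).

Lemma syllA_insert p u : pA u <> 1 -> pA (iA p * (iB t * u)) = p.
Proof.
move=> /(syllAB nf) u1; apply: (syllA_cons nf).
by rewrite (syllB_consA (syllables_swap nf)).
Qed.

(** Cut [(q i)^-1 * a] at [r] of the points [q], insert [t] at each cut, and append an
    element of [Y]. Each cut is placed relative to the previous one, at one of [width]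
    multiples of [step], so that consecutive cuts are at least [step] apart and the
    pieces between them are nontrivial. *)
Fixpoint insertions (q : nat -> A) (a : A) (step width : nat) (Y : seq G)
    (r i : nat) : seq G :=
  match r with
  | 0 => [seq iA ((q i)^-1 * a) * y | y <- Y]
  | r'.+1 => [seq iA ((q i)^-1 * q (i + step * c.+1)%N) * (iB t * u) |
      c <- iota 0 width, u <- insertions q a step width Y r' (i + step * c.+1)%N]
  end.

(** Undoes [r] insertions: the pieces are the first [r.+1] syllables of [u] in [A]. *)
Fixpoint peel (r : nat) (u : G) : A :=
  match r with
  | 0 => pA u
  | r'.+1 => pA u * peel r' ((iB t)^-1 * ((iA (pA u))^-1 * u))
  end.

Lemma size_insertions q a step width Y r i :
  size (insertions q a step width Y r i) = (width ^ r * size Y)%N.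
Proof.
elim: r i => [|r IH] i /=; first by rewrite size_map mul1n.
rewrite size_allpairs_dep sumnE big_map (eq_bigr (fun=> (width ^ r * size Y)%N)) //.
by rewrite big_const_seq count_predT iter_addn_0 size_iota mulnC mulnA -expnS.
Qed.

Section Milestones.
Variables (a : A) (m d : nat) (q : nat -> A) (width : nat) (Y : seq G) (l : nat).
Hypothesis q_end : q m = a.
Hypothesis q_le : forall i j, (i <= j <= m)%N ->
  (norm (iA ((q i)^-1 * q j)%g) <= j - i + d)%N.
Hypothesis q_ge : forall i j, (i <= j <= m)%N ->
  (j - i <= norm (iA ((q i)^-1 * q j)%g) + d)%N.
Hypothesis Y_A : forall y, y \in Y -> pA y = 1.
Hypothesis Y_le : forall y, y \in Y -> (norm y <= l)%N.
Local Notation step := d.+1.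
Local Notation ins := (insertions q a step width Y).

(** Condition for [r] cuts from position [i] on. The additional [step] after the last
    cut makes the last piece nontrivial; without any cut this is [q i <> a]. *)
Definition room (r i : nat) : Prop :=
  [/\ q i <> a, (i + r * (step * width) <= m)%N &
      ((0 < r) -> i + r * (step * width) + step <= m)%N].

Lemma milestone_neq i j : (i + step <= j)%N -> (j <= m)%N -> q i <> q j.
Proof.
move=> ij jm e; have : (i <= j <= m)%N by lia.
by move/q_ge; rewrite e mulVg group_morph1 wnorm1 //; lia.
Qed.

Lemma room_step r i c : (c < width)%N -> room r.+1 i ->
  room r (i + step * c.+1) /\ (i + step <= i + step * c.+1 <= m)%N.
Proof.
move=> cw [_ _ /(_ isT) le].
have le1 : (step * c.+1 <= step * width)%N by rewrite leq_mul2l cw orbT.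
have le2 : (step <= step * c.+1)%N by rewrite leq_pmulr.
have le3 : (i + step * c.+1 + r * (step * width) + step <= m)%N.
  by apply: leq_trans le; rewrite mulSn; lia.
split; last by apply/andP; split; lia.
split; [|lia|by move=> _; lia].
by rewrite -q_end; apply: milestone_neq; lia.
Qed.

(** Every piece is nontrivial, so no cancellation occurs and the syllables can be read
    off. Each insertion costs the norm of [t] and the error [d] of one milestone. *)
Lemma insertions_spec r i u : room r i -> u \in ins r i ->
  [/\ pA u <> 1, peel r u = (q i)^-1 * a &
     (norm u <= (m - i) + d + l + r * (norm (iB t) + d))%N].
Proof.
elim: r i u => [|r IH] i u Hr /=.
  case: Hr => qa; rewrite mul0n addn0 => im _ /mapP [y yY ->].
  rewrite (syllA_cons nf) ?Y_A //; split=> // [e|].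
    by apply: qa; rewrite -[a](mulVKg (q i)) e mulg1.
  rewrite addn0; apply: leq_trans (wnormM hS _ _) _; apply: leq_add (Y_le yY).
  by rewrite -{1}q_end q_le // im /=.
move=> /allpairsPdep [c [v [cw vin ->]]]; rewrite mem_iota add0n in cw.
have [Hr' /andP [ij jm]] := room_step cw Hr.
set j := (i + _)%N in Hr' ij jm vin *.
have [v1 pv le] := IH j v Hr' vin.
rewrite (syllA_insert _ v1); split.
- move=> e; apply: (milestone_neq ij jm).
  by rewrite -[q j](mulVKg (q i)) e mulg1.
- by rewrite !mulKg pv mulgA mulgK.
have le1 : (norm (iA ((q i)^-1 * q j)%g) <= j - i + d)%N.
  by apply: q_le; rewrite jm andbT; lia.
have -> : iA ((q i)^-1 * q j) * (iB t * v) = iA ((q i)^-1 * q j) * iB t * v.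
  by rewrite mulgA.
apply: leq_trans (wnormM3 hS le1 (leqnn _) le) _.
rewrite mulSn; lia.
Qed.

(** The first syllable determines the first cut, because milestones at distance more
    than [d] are distinct. *)
Lemma insertions_uniq r i : uniq Y -> room r i -> uniq (ins r i).
Proof.
move=> Y_uniq; elim: r i => [|r IH] i Hr /=.
  by rewrite map_inj_uniq //; apply: mulgI.
apply: allpairs_uniq_dep; first exact: iota_uniq.
  by move=> c; rewrite mem_iota => /andP [_ cw]; have [/IH] := room_step cw Hr.
move=> _ _ /allpairsPdep [c [v [cw vin ->]]] /allpairsPdep [c' [v' [cw' vin' ->]]] /=.
rewrite mem_iota add0n in cw; rewrite mem_iota add0n in cw'.
have [Hc /andP [_ jm]] := room_step cw Hr.
have [Hc' /andP [_ jm']] := room_step cw' Hr.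
have [v1 _ _] := insertions_spec Hc vin.
have [v1' _ _] := insertions_spec Hc' vin'.
move=> e; have := congr1 pA e; rewrite !syllA_insert // => /mulgI eq.
have ec : c = c'.
  have neq x y : (x < y)%N -> (i + step * y.+1 <= m)%N ->
      q (i + step * x.+1)%N <> q (i + step * y.+1)%N.
    move=> xy; apply: milestone_neq; rewrite -addnA leq_add2l -mulnSr leq_mul2l.
    by rewrite ltnS xy orbT.
  case: (ltngtP c c') => // lt; first by case: (neq _ _ lt jm').
  by case: (neq _ _ lt jm).
subst c'; congr Tagged.
by apply: (mulgI (iB t)); apply: mulgI e.
Qed.
End Milestones.

(** The images of [x * iA a * x^-1], together with what is needed to recover it from an
    image [u]: the conjugator [x] is close to a vertex of any path to [u], and [x]
    and [u] determine [a]. *)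
Lemma insertion_images D (x : G) (a : A) Q (Y : seq G) l r :
  let k := norm x in let m := norm (iA a) in
  let d := (6 * D)%N in
  let R := (k + (m + d + l + r * (norm (iB t) + d)))%N in
  bottleneck S iA pA D -> pA x^-1 = 1 -> a <> 1 ->
  uniq Y -> (forall y, y \in Y -> pA y = 1 /\ (norm y <= l)%N) ->
  (r * (d.+1 * Q) <= m)%N -> ((0 < r) -> r * (d.+1 * Q) + d.+1 <= m)%N ->
  exists I : seq G, [/\ uniq I, size I = (Q ^ r * size Y)%N &
    forall u, u \in I -> [/\ (norm u <= R)%N,
      peel r (x^-1 * u) = a &
      forall w, is_word S w -> word_val w = u ->
        exists2 i, (i <= size w)%N & (norm (x^-1 * word_val (take i w))%g <= D)%N]].
Proof.
move=> k m d R HD x1 na Yu HY rm rm'.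
have [q [q0 qm qd]] := milestones_exist hS nf HD a.
have q_le i j : (i <= j <= m)%N -> (norm (iA ((q i)^-1 * q j)%g) <= j - i + d)%N.
  by move=> /qd [].
have q_ge i j : (i <= j <= m)%N -> (j - i <= norm (iA ((q i)^-1 * q j)%g) + d)%N.
  by move=> /qd [].
have YA y : y \in Y -> pA y = 1 by move=> /HY [].
have Yl y : y \in Y -> (norm y <= l)%N by move=> /HY [].
have Hr : room a m d q Q r 0.
  by split; rewrite ?add0n // q0 => e; apply: na.
exists [seq x * u | u <- insertions q a d.+1 Q Y r 0]; split.
- rewrite map_inj_uniq; last exact: mulgI.
  exact: (insertions_uniq (m := m) qm q_le q_ge YA Yl Yu).
- by rewrite size_map size_insertions.
move=> _ /mapP [u uin ->].
have [u1 pu le] := insertions_spec qm q_le q_ge YA Yl Hr uin.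
split.
- by apply: leq_trans (wnormM hS _ _) _; rewrite leq_add2l -[m in leqRHS]subn0.
- by rewrite mulKg pu q0 invg1 mul1g.
move=> w ww we.
have [||[w1 [w2 [ew le1]]] _] :=
  @passes_near _ _ _ _ _ _ _ _ _ hS nf _ HD x (pA u) ((iA (pA u))^-1 * u) w x1 _ u1 ww.
- by rewrite -group_morphV (syllA nf) mulVg.
- by rewrite we -mulgA mulVKg.
exists (size w1); first by rewrite ew size_cat leq_addr.
by rewrite ew take_size_cat.
Qed.

End Insertion.

(** * Counting elliptic elements *)

Section Counting.
Variables (A B G : groupType) (S : {fset G}).
Variables (iA : {multiplicative A -> G}) (iB : {multiplicative B -> G}).
Variables (pA : G -> A) (pB : G -> B) (len : G -> nat).
Hypothesis hS : generates S.
Hypothesis nf : syllables iA iB pA pB len.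
Local Notation norm := (wnorm S).
Local Notation growth := (growth S).

Variables (b0 b1 : B) (a0 a1 : A).
Hypothesis nb0 : b0 <> 1.
Hypothesis nb1 : b1 <> 1.
Hypothesis na0 : a0 <> 1.
Hypothesis na1 : a1 <> 1.
Hypothesis n01 : (b0, a0) <> (b1, a1).

Variable K : nat.
Hypothesis leK0 : (norm (iB b0 * iA a0)%g <= K)%N.
Hypothesis leK1 : (norm (iB b1 * iA a1)%g <= K)%N.

(** The products of [j] factors, each of which is [b0 a0] or [b1 a1]: normal forms show
    that they are distinct and do not begin in [A]. *)
Lemma free_submonoid j : exists Y : seq G, [/\ uniq Y, size Y = (2 ^ j)%N &
  forall y, y \in Y -> pA y = 1 /\ (norm y <= j * K)%N].
Proof.
elim: j => [|j [Y [Yu sY HY]]].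
  exists [:: 1]; split=> // y; rewrite inE => /eqP ->.
  by rewrite (syllA1 nf) wnorm1.
have nf' := syllables_swap nf.
have headA a y : y \in Y -> pA (iA a * y) = a.
  by move=> /HY [y1 _]; rewrite (syllA_cons nf).
have headB b a y : a <> 1 -> y \in Y -> pB (iB b * (iA a * y)) = b.
  by move=> na yY; rewrite (syllA_cons nf') // (syllAB nf) // headA.
exists ([seq iB b0 * (iA a0 * y) | y <- Y] ++ [seq iB b1 * (iA a1 * y) | y <- Y]).
split.
- rewrite cat_uniq !map_inj_uniq ?Yu ?andbT; first last.
  + by move=> u v /mulgI /mulgI.
  + by move=> u v /mulgI /mulgI.
  apply/hasPn => _ /mapP [y yY ->]; apply/mapP => -[z zY] e.
  have := congr1 pB e; rewrite !headB // => eb; apply: n01.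
  have := congr1 (fun u => pA ((iB b0)^-1 * u)) e.
  by rewrite mulKg -eb mulKg !headA // => ->.
- by rewrite size_cat !size_map sY expnS mul2n addnn.
have key b a y : b <> 1 -> a <> 1 -> (norm (iB b * iA a)%g <= K)%N -> y \in Y ->
    pA (iB b * (iA a * y)) = 1 /\ (norm (iB b * (iA a * y))%g <= j.+1 * K)%N.
  move=> nb na leK yY; split.
    by rewrite (syllB_consA nf') // (syllAB nf) // headA.
  rewrite mulgA mulSn; apply: leq_trans (wnormM hS _ _) _.
  by apply: leq_add => //; have [] := HY y yY.
by move=> y; rewrite mem_cat => /orP [] /mapP [z zY ->]; apply: key.
Qed.

Lemma growth_exponential n : (2 ^ (n %/ K) <= growth n)%N.
Proof.
have [Y [Yu <- HY]] := free_submonoid (n %/ K).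
apply: size_le_growth => // y /HY [_ /leq_trans]; apply; exact: leq_trunc_div.
Qed.

Variable D : nat.
Hypothesis HD : bottleneck S iA pA D.

(** Fixing [k] and [m] makes the number of images uniform, as double counting requires. *)
Definition elliptic_of_size (n k m : nat) (g : G) : Prop :=
  (norm g <= n)%N /\ exists x a, [/\ g = x * iA a * x^-1, pA x^-1 = 1, a <> 1,
    norm x = k & norm (iA a) = m].

(** Double counting with the images of [insertion_images] and [j] factors of the free
    monoid. The fibre over [u] is covered by decoding [u] with every conjugator within
    [D] of one of the at most [R.+1] vertices of a chosen geodesic. *)
Lemma elliptic_count n k m r j Q (E : seq G) :
  let d := (6 * D)%N in
  let L := (norm (iB b0) + d)%N in
  let R := (n + 4 * D + d + r * L)%N in
  uniq E -> (forall g, g \in E -> elliptic_of_size n k m g) ->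
  (k + m + j * K <= n + 4 * D)%N ->
  (r * (d.+1 * Q) <= m)%N -> ((0 < r) -> r * (d.+1 * Q) + d.+1 <= m)%N ->
  (size E * (Q ^ r * 2 ^ j) <= growth R * (R.+1 * growth D))%N.
Proof.
move=> d L R Eu HE le_n rm rm'.
have [Y [Yu sY HY]] := free_submonoid j.
have /choice [w Hw] := geodesic hS.
pose dec u v := v * iA (peel iA iB pA b0 r (v^-1 * u)) * v^-1.
pose F u := [seq dec u (word_val (take i (w u)) * h) | i <- iota 0 R.+1, h <- wball S D].
have : forall g, exists I : seq G, g \in E -> [/\ uniq I, size I = (Q ^ r * 2 ^ j)%N &
    forall u, u \in I -> u \in wball S R /\ g \in F u].
  move=> g; case: (boolP (g \in E)) => [gE|]; last by exists [::].
  have [gn [x [a [-> x1 na xk am]]]] := HE g gE.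
  have [||I [Iu sI HI]] := @insertion_images A B G S iA iB pA pB len hS nf b0 nb0 D x a Q Y
    (j * K) r HD x1 na Yu HY; rewrite ?am //.
  exists I => _; split=> // [|u /HI [un eg near]]; first by rewrite sI sY.
  have uR : (norm u <= R)%N by apply: leq_trans un _; rewrite xk am /R -/d -/L; lia.
  split; first by rewrite mem_wball.
  have [ww sw wu] := Hw u.
  have [i iw le] := near _ ww wu.
  apply/allpairsP; exists (i, (word_val (take i (w u)))^-1 * x); split.
  - rewrite mem_iota add0n ltnS; apply: leq_trans iw _; rewrite sw; exact: uR.
  - by rewrite mem_wball // -(wnormV hS) invgM invgK.
  - by rewrite /dec mulVKg eg.
move=> /choice [I HI].
apply: (@double_count _ _ E (wball S R) I F).
- exact: Eu.
- by move=> g /HI [].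
- by move=> g /HI [_ ->].
- by move=> g u /HI [_ _ H] /H.
- by move=> u; rewrite size_allpairs size_iota.
Qed.

End Counting.

(** As [m + (N - k - m) = N - k] is at least [N / 2], one of [r] and [j] is large. *)
Lemma exponent_bound (n k m r j P K M N : nat) : (0 < K)%N -> (n <= N)%N ->
  (k + m + k <= N)%N -> r = ((m - M) %/ P)%N -> (0 < P)%N -> j = ((N - k - m) %/ K)%N ->
  (n %/ (2 * (P + K)) <= r + j + 2 + M)%N.
Proof.
move=> K0 nN km er P0 ej.
have m_lt : (m < r.+1 * P + M)%N by have := ltn_ceil (m - M) P0; rewrite -er; lia.
have l_lt : (N - k - m < j.+1 * K)%N by have := ltn_ceil (N - k - m) K0; rewrite -ej; lia.
rewrite -ltnS ltn_divLR; last by lia.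
have le1 : (r.+1 * P <= (r + j + 2) * P)%N by rewrite leq_mul2r; apply/orP; right; lia.
have le2 : (j.+1 * K <= (r + j + 2) * K)%N by rewrite leq_mul2r; apply/orP; right; lia.
have le3 : (M <= M * (P + K))%N by apply: leq_pmulr; lia.
lia.
Qed.

Lemma radius_bound (n r L c D : nat) : (r <= n + D)%N ->
  ((n + c + r * L).+1 <= n.+1 * (c + L + D * L).+1)%N.
Proof.
move=> rn; have : (r * L <= (n + D) * L)%N by rewrite leq_mul2r rn orbT.
lia.
Qed.

Section Bound.
Variables (A B G : groupType) (S : {fset G}).
Variables (iA : {multiplicative A -> G}) (iB : {multiplicative B -> G}).
Variables (pA : G -> A) (pB : G -> B) (len : G -> nat).
Hypothesis hS : generates S.
Hypothesis nf : syllables iA iB pA pB len.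
Local Notation norm := (wnorm S).
Local Notation growth := (growth S).

Variables (b0 b1 : B) (a0 a1 : A).
Hypothesis nb0 : b0 <> 1.
Hypothesis nb1 : b1 <> 1.
Hypothesis na0 : a0 <> 1.
Hypothesis na1 : a1 <> 1.
Hypothesis n01 : (b0, a0) <> (b1, a1).
Variable K : nat.
Hypothesis K_gt0 : (0 < K)%N.
Hypothesis leK0 : (norm (iB b0 * iA a0)%g <= K)%N.
Hypothesis leK1 : (norm (iB b1 * iA a1)%g <= K)%N.
Variable D : nat.
Hypothesis HD : bottleneck S iA pA D.

Lemma elliptic_of_size_le n k m g :
  elliptic_of_size S iA pA n k m g -> (k + m + k <= n + 4 * D)%N.
Proof.
move=> [gn [x [a [eg x1 na <- <-]]]].
have [w [ww sw we]] := geodesic hS g; rewrite eg in we.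
have [_] := passes_near hS nf HD x1 x1 na ww we.
rewrite (wnormV hS) => /leq_trans; apply.
by rewrite leq_add2r sw.
Qed.

(** Choose [Q] twice the factor by which one insertion can enlarge the ball. The factor
    [growth 1 ^ (L * r)] then cancels, and [2 ^ r] remains. *)
Lemma elliptic_of_size_bound : exists C T, (K <= T)%N /\
  forall n k m (E : seq G), uniq E ->
    (forall g, g \in E -> elliptic_of_size S iA pA n k m g) ->
    (size E * 2 ^ (n %/ T) <= C * n.+1 * growth n)%N.
Proof.
pose d := (6 * D)%N; pose L := (norm (iB b0) + d)%N.
pose Q := (2 * growth 1 ^ L)%N; pose P := (d.+1 * Q)%N.
have Q0 : (0 < Q)%N by rewrite muln_gt0 expn_gt0 (growth_gt0 hS).
have P0 : (0 < P)%N by rewrite muln_gt0.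
pose c := (4 * D + d)%N.
exists (2 ^ (2 + d.+1) * (growth 1 ^ c * (c + L + 4 * D * L).+1 * growth D))%N.
exists (2 * (P + K))%N; split; first by lia.
move=> n k m E Eu HE.
(* For nonempty [E] the geometry gives [2 k + m <= n + 4 D]. *)
have [->|[g0 gE]] : E = [::] \/ exists g, g \in E.
  by case: (E) => [|g E']; [left | right; exists g; rewrite mem_head].
  by [].
have km := elliptic_of_size_le (HE g0 gE).
pose r := ((m - d.+1) %/ P)%N; pose j := ((n + 4 * D - k - m) %/ K)%N.
have jK : (k + m + j * K <= n + 4 * D)%N.
  have := leq_trunc_div (n + 4 * D - k - m) K; rewrite -/j; lia.
have rP : (r * P <= m - d.+1)%N by apply: leq_trunc_div.
have rm : (r <= n + 4 * D)%N.
  have : (r <= r * P)%N by rewrite leq_pmulr.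
  lia.
have r_pos : (0 < r -> r * P + d.+1 <= m)%N.
  case: (leqP d.+1 m) => [le _|lt]; first by lia.
  by rewrite /r (eqP (ltnW lt : m - d.+1 == 0)%N) div0n.
have := elliptic_count hS nf nb0 nb1 na0 na1 n01 leK0 leK1 HD Eu HE jK
  (leq_trans rP (leq_subr _ _)) r_pos.
rewrite -/d -/L -addnA -addnA (addnA (4 * D)%N) -/c.
have le_growth : (growth (n + (c + r * L)) <=
    growth n * growth 1 ^ c * growth 1 ^ (L * r))%N.
  by apply: leq_trans (growthDn hS _ _) _; rewrite expnD mulnA (mulnC L).
have le_R := @radius_bound n r L c (4 * D) rm.
rewrite -addnA in le_R.
have le_e := @exponent_bound n k m r j P K d.+1 (n + 4 * D)
  K_gt0 (leq_addr _ _) km erefl P0 erefl.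
set X := size E; set R := (n + (c + r * L))%N in le_growth le_R *.
rewrite /Q expnMn -expnM => count.
have G0 : (0 < growth 1 ^ (L * r))%N by rewrite expn_gt0 (growth_gt0 hS).
have count' : (X * 2 ^ (r + j) <= growth n * growth 1 ^ c * (R.+1 * growth D))%N.
  rewrite -(leq_pmul2r G0) expnD.
  apply: leq_trans (leq_trans (_ : _ <= _)%N count) _.
    by rewrite eq_leq // -!mulnA; congr (_ * (_ * _))%N; rewrite mulnC.
  by rewrite mulnAC leq_mul2r le_growth orbT.
have : (2 ^ (n %/ (2 * (P + K))) <= 2 ^ (r + j) * 2 ^ (2 + d.+1))%N.
  by rewrite -expnD leq_exp2l // addnA.
move=> le2; apply: leq_trans (leq_mul (leqnn X) le2) _.
rewrite mulnA; apply: leq_trans (leq_mul count' (leqnn _)) _.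
rewrite [leqLHS](_ : _ =
  growth n * growth 1 ^ c * growth D * 2 ^ (2 + d.+1) * R.+1)%N; last by lia.
apply: leq_trans (leq_mul (leqnn _) le_R) _.
by apply: eq_leq; lia.
Qed.

End Bound.

(** * Growth tightness of elliptic elements *)

Lemma size_flatten_le (T : eqType) (ss : seq (seq T)) (c b : nat) :
  (forall s, s \in ss -> size s * c <= b)%N ->
  (size (flatten ss) * c <= size ss * b)%N.
Proof.
elim: ss => [|s ss IH] H //=.
rewrite size_cat mulnDl mulSn; apply: leq_add; first by apply: H; rewrite mem_head.
by apply: IH => s' s'in; apply: H; rewrite inE s'in orbT.
Qed.

(** A conjugate [x^-1 a x] can be rewritten with a conjugator that does not begin in
    [A], by absorbing the first syllable of [x] into [a]. It remains to sum over the
    polynomially many values of [k] and [m], and to add the identity element. *)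
Lemma elliptic_growth_tight (A B G : groupType) (S : {fset G})
    (iA : {multiplicative A -> G}) (iB : {multiplicative B -> G})
    (pA : G -> A) (pB : G -> B) (len : G -> nat) (b0 b1 : B) (a0 a1 : A) :
  generates S -> syllables iA iB pA pB len ->
  b0 <> 1 -> b1 <> 1 -> a0 <> 1 -> a1 <> 1 -> (b0, a0) <> (b1, a1) ->
  exists C T, (0 < T)%N /\ forall n (E : seq G), uniq E ->
    (forall g, g \in E -> (wnorm S g <= n)%N /\ conjugate_into iA g) ->
    (size E * 2 ^ (n %/ T) <= C * n.+1 ^ 3 * growth S n)%N.
Proof.
move=> hS nf nb0 nb1 na0 na1 n01.
have [D HD] := bottleneck_exists hS nf.
pose K := (maxn (wnorm S (iB b0 * iA a0)%g) (wnorm S (iB b1 * iA a1)%g)).+1.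
have leK0 : (wnorm S (iB b0 * iA a0)%g <= K)%N by rewrite leqW // leq_maxl.
have leK1 : (wnorm S (iB b1 * iA a1)%g <= K)%N by rewrite leqW // leq_maxr.
have [C [T [KT HC]]] :=
  elliptic_of_size_bound hS nf nb0 nb1 na0 na1 n01 (ltn0Sn _ : 0 < K)%N leK0 leK1 HD.
exists (1 + (4 * D).+1 * (4 * D).+1 * C)%N, T; split; first by apply: leq_trans KT.
move=> n E Eu HE.
pose N := (n + 4 * D).+1.
pose piece k m := [seq g <- E | `[< elliptic_of_size S iA pA n k m g >]].
pose pieces := [seq piece k m | k <- iota 0 N, m <- iota 0 N].
have sub : {subset E <= 1 :: flatten pieces}.
  move=> g gE; have [gn [a [x eg]]] := HE g gE; rewrite inE.
  (* The element [c] is the conjugate of [a] by the first syllable of [x]. *)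
  pose p := pA x; pose y := (iA p)^-1 * x; pose c := p^-1 * a * p.
  have y1 : pA y = 1 by rewrite /y -group_morphV (syllA nf) mulVg.
  have egy : g = y^-1 * iA c * y^-1^-1.
    by rewrite eg conjgE /y /c !gmulfM group_morphV invgK invgM invgK !mulgA !mulgK.
  have [c1|/eqP nc] := eqVneq c 1.
    by rewrite egy c1 group_morph1 mulg1 mulgV eqxx.
  have el : elliptic_of_size S iA pA n (wnorm S y^-1) (wnorm S (iA c)) g.
    by split=> //; exists y^-1, c; rewrite invgK in egy *.
  have := elliptic_of_size_le hS nf HD el => le.
  apply/orP; right; apply/flattenP; exists (piece (wnorm S y^-1) (wnorm S (iA c))).
    by apply: allpairs_f; rewrite mem_iota add0n /= /N; lia.
  by rewrite mem_filter gE andbT; apply/asboolP.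
have sE : (size E <= 1 + size (flatten pieces))%N by apply: uniq_leq_size Eu sub.
have le_pieces : (size (flatten pieces) * 2 ^ (n %/ T) <=
    size pieces * (C * n.+1 * growth S n))%N.
  apply: size_flatten_le => s /allpairsP [[k m] [_ _ ->]] /=.
  apply: (HC n k m); first exact: filter_uniq.
  by move=> g; rewrite mem_filter => /andP [/asboolP].
have le1 : (2 ^ (n %/ T) <= growth S n)%N.
  apply: leq_trans (growth_exponential hS nf nb0 nb1 na0 na1 n01 leK0 leK1 n).
  by rewrite leq_exp2l //; exact: leq_div2l KT.
apply: leq_trans (leq_mul sE (leqnn _)) _; rewrite mulnDl mul1n.
apply: leq_trans (leq_add le1 le_pieces) _.
rewrite size_allpairs size_iota 2!mulnDl mul1n; apply: leq_add.
  by rewrite leq_pmull // expn_gt0.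
have NN : (N <= (4 * D).+1 * n.+1)%N by rewrite /N mulSn mulnS; lia.
apply: leq_trans (leq_mul (leq_mul NN NN) (leqnn _)) _.
by rewrite !expnS expn0; apply: eq_leq; lia.
Qed.

Lemma is_free_product_iso (A A' B B' G : groupType)
    (iA : {multiplicative A -> G}) (iB : {multiplicative B -> G})
    (f : {multiplicative A' -> A}) (f' : {multiplicative A -> A'})
    (g : {multiplicative B' -> B}) (g' : {multiplicative B -> B'}) :
  cancel f f' -> cancel f' f -> cancel g g' -> cancel g' g ->
  is_free_product iA iB -> is_free_product (iA \o f) (iB \o g).
Proof.
move=> fK f'K gK g'K hG H u v.
have [h [hu hv] h_uniq] := hG H (u \o f') (v \o g').
exists h; first by split=> x /=; [rewrite [LHS]hu /= fK | rewrite [LHS]hv /= gK].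
move=> h' [h'u h'v]; apply: h_uniq; split=> x /=.
  by rewrite -[in LHS](f'K x) [LHS]h'u.
by rewrite -[in LHS](g'K x) [LHS]h'v.
Qed.

(** In a group with only two elements, [a * a] cannot be [a]. *)
Lemma iso_Z2 (A : groupType) (a : A) : a <> 1 -> (forall x, x <> 1 -> x = a) ->
  exists (f : {multiplicative 'Z_2 -> A}) (f' : {multiplicative A -> 'Z_2}),
    cancel f f' /\ cancel f' f.
Proof.
move=> na a_uniq.
have aa : a * a = 1.
  have [//|/eqP/a_uniq aa] := eqVneq (a * a) 1.
  by case: na; apply: (mulgI a); rewrite mulg1.
have Z2P (x : 'Z_2) : x = 1%g \/ x = 1%R.
  by case: x => [[|[|m]] xlt]; [left|right|]; try exact: val_inj.
pose f (x : 'Z_2) : A := if x == 1%g then 1 else a.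
have f1 : f 1%g = 1 by rewrite /f eqxx.
have fa : f 1%R = a by [].
have fM : {morph f : x y / x * y}.
  move=> x y; case: (Z2P x) => ->; first by rewrite f1 !mul1g.
  case: (Z2P y) => ->; first by rewrite f1 !mulg1.
  by rewrite fa aa.
pose F : {multiplicative 'Z_2 -> A} := HB.pack f (isMultiplicative.Build 'Z_2 A f fM).
pose f' (x : A) : 'Z_2 := if x == 1 then 1%g else (1%R : 'Z_2).
have fK : cancel f f'.
  move=> x; case: (Z2P x) => ->; first by rewrite f1 /f' eqxx.
  by rewrite fa /f'; case: eqP.
have f'K : cancel f' f.
  by move=> x; rewrite /f'; case: eqP => [->|/a_uniq ->].
have f'M : {morph f' : x y / x * y} := @can2_gmulfM _ _ F f' fK f'K.
pose F' : {multiplicative A -> 'Z_2} := HB.pack f' (isMultiplicative.Build A 'Z_2 f' f'M).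
by exists F, F'.
Qed.

(** Otherwise both factors have order two, and [G] is elementary. *)
Lemma two_syllables (A B G : groupType)
    (iA : {multiplicative A -> G}) (iB : {multiplicative B -> G}) :
  is_free_product iA iB -> nontrivial A -> nontrivial B -> ~ iso_Z2_free_Z2 G ->
  exists (b0 b1 : B) (a0 a1 : A),
    [/\ b0 <> 1, b1 <> 1, a0 <> 1, a1 <> 1 & (b0, a0) <> (b1, a1)].
Proof.
move=> hG [a /eqP na] [b /eqP nb] hne; apply: contrapT => no; apply: hne.
have a_uniq x : x <> 1 -> x = a.
  by move=> nx; apply: contrapT => xa; apply: no; exists b, b, x, a; split=> // -[].
have b_uniq x : x <> 1 -> x = b.
  by move=> nx; apply: contrapT => xb; apply: no; exists x, b, a, a; split=> // -[].
have [f [f' [fK f'K]]] := iso_Z2 na a_uniq.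
have [g [g' [gK g'K]]] := iso_Z2 nb b_uniq.
by exists (iA \o f), (iB \o g); apply: is_free_product_iso hG; eassumption.
Qed.

(** * From counting to exponential decay *)

Import Order.TTheory GRing.Theory Num.Theory.

(** From [q = 6] on, [((q + 2) / (q + 1)) ^ 3] is at most [3 / 2]; the constant covers
    the first values. *)
Lemma cube_exp2_le (q : nat) : (q.+1 ^ 3 * 2 ^ q <= 31 * 3 ^ q)%N.
Proof.
elim: q => // q IH.
have [/= le|lt] := leqP 6 q; last first.
  by clear IH; do 6![case: q lt => [|q] lt; first by []].
rewrite !expnS expn0 in IH *.
have le3 : (2 * (q.+2 * (q.+2 * (q.+2 * 1))) <= 3 * (q.+1 * (q.+1 * (q.+1 * 1))))%N by nia.
nia.
Qed.

Section Estimate.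
Local Open Scope ring_scope.

Lemma bernoulli_ineq (R : realType) (y : R) (n : nat) :
  0 <= y <= 1 -> 1 - n%:R * y <= (1 - y) ^+ n.
Proof.
move=> /andP [y0 y1]; elim: n => [|n IH]; first by rewrite expr0; lra.
rewrite exprS -natr1; have n0 : 0 <= n%:R :> R by [].
by nra.
Qed.

(** With [q = n / T], the bound is at most a constant times [(q+1)^3 2^(-q)], hence times
    [(3/4)^q] by [cube_exp2_le]. The rate [lambda = 1 - 1/(4 T)] satisfies
    [lambda ^ T >= 3/4], so that no roots are needed. *)
Lemma geometric_bound (R : realType) (C T : nat) : (0 < T)%N ->
  exists c lambda : R, [/\ 0 < c, 0 < lambda < 1 &
    forall n x g : nat, (0 < g)%N ->
      (x * 2 ^ (n %/ T) <= C * n.+1 ^ 3 * g)%N ->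
      x%:R / g%:R <= c * lambda ^+ n].
Proof.
move=> T0.
have T1 : 1 <= T%:R :> R by rewrite ler1n.
pose y : R := (4 * T%:R)^-1; pose lambda : R := 1 - y.
have iT : 0 < y <= 4^-1.
  have T4 : 4 <= 4 * T%:R :> R by lra.
  apply/andP; split; first by rewrite invr_gt0; lra.
  by rewrite lef_pV2 // posrE; lra.
have l01 : 0 < lambda < 1 by rewrite /lambda; move: iT; lra.
have lT : 3 / 4 <= lambda ^+ T.
  have := @bernoulli_ineq R y T; rewrite -/lambda.
  have -> : T%:R * y = 4^-1.
    by rewrite /y invfM mulrCA divff ?mulr1 // lt0r_neq0 // ltr0n.
  by move=> H; apply: le_trans (H _); move: iT; lra.
pose c : R := (C.+1 * T ^ 3 * 31)%:R * (4 / 3).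
exists c, lambda; split=> //.
  by rewrite mulr_gt0 ?ltr0n ?muln_gt0 ?expn_gt0 ?T0 //; lra.
move=> n x g g0 H; set q := (n %/ T)%N in H.
have nq : (n.+1 <= T * q.+1)%N by rewrite mulnC ltn_ceil.
have H1 : (x * 4 ^ q <= (C.+1 * T ^ 3 * 31) * g * 3 ^ q)%N.
  have -> : (4 ^ q = 2 ^ q * 2 ^ q)%N by rewrite -expnMn.
  rewrite mulnA; apply: leq_trans (leq_mul H (leqnn _)) _.
  have H3 : (n.+1 ^ 3 <= T ^ 3 * q.+1 ^ 3)%N by rewrite -expnMn leq_exp2r.
  have := leq_mul (leqnn (C.+1 * T ^ 3 * g)) (cube_exp2_le q).
  have : (C * n.+1 ^ 3 <= C.+1 * (T ^ 3 * q.+1 ^ 3))%N by apply: leq_mul.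
  move=> H4 H5; apply: leq_trans (leq_mul (leq_mul H4 (leqnn g)) (leqnn _)) _.
  apply: leq_trans (leq_trans H5 _); apply: eq_leq; lia.
have lq : (3 / 4) ^+ q.+1 <= lambda ^+ n.
  apply: (@le_trans _ _ (lambda ^+ (T * q.+1))).
    by rewrite exprM lerXn2r // ?nnegrE ?exprn_ge0 //; move: l01; lra.
  by apply: ler_wiXn2l; [move: l01; lra | move: l01; lra | apply: ltnW].
rewrite ler_pdivrMr ?ltr0n //.
have c0 : 0 <= c by rewrite mulr_ge0 //; lra.
apply: le_trans (ler_wpM2r (ler0n _ g) (ler_wpM2l c0 lq)).
rewrite -(ler_nat R) !natrM !natrX in H1.
rewrite expr_div_n /c !natrM exprS.
have p4 : 0 < 4 ^+ q :> R by rewrite exprn_gt0.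
rewrite -(ler_pM2r p4); apply: le_trans H1 _.
rewrite le_eqVlt; apply/orP; left; apply/eqP.
rewrite !exprS; field.
by rewrite lt0r_neq0.
Qed.

End Estimate.

(** * Proportions of balls *)

Section BallProportion.
Variables (G : groupType) (S : {fset G}).
Hypothesis hS : generates S.

Lemma card_ball_setI (X : set G) n :
  #|` fset_set (word_ball S 1 n `&` X)|%fset =
  count (fun g => `[< X g >]) (wball S n).
Proof.
have -> : word_ball S 1 n `&` X =
    [set` [fset g in [seq g <- wball S n | `[< X g >]]]%fset].
  apply/seteqP; split=> g /=.
    by move=> [gn Xg]; rewrite inE mem_filter mem_wball // gn andbT; apply/asboolP.
  by rewrite inE mem_filter mem_wball // => /andP [/asboolP].
by rewrite set_fsetK card_fseq undup_id ?size_filter // filter_uniq // uniq_wball.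
Qed.

Lemma card_ball n : #|` fset_set (word_ball S 1 n)|%fset = growth S n.
Proof.
rewrite -[word_ball S 1 n]setIT card_ball_setI /growth -[in RHS]count_predT.
by apply: eq_count => g; apply/asboolP.
Qed.

Lemma ball_proportion_dist (R : realType) (X : set G) n :
  (`|ball_proportion R S X n - 1| =
    (count (fun g => `[< ~ X g >]) (wball S n))%:R / (growth S n)%:R)%R.
Proof.
have g0 : (0 < (growth S n)%:R :> R)%R by rewrite ltr0n growth_gt0.
rewrite /ball_proportion card_ball_setI card_ball.
have e : ((growth S n)%:R = (count (fun g => `[< X g >]) (wball S n))%:R +
    (count (fun g => `[< ~ X g >]) (wball S n))%:R :> R)%R.
  rewrite -natrD /growth -(count_predC (fun g => `[< X g >]) (wball S n)).
  by congr (_ + _)%:R%R; apply: eq_count => g /=; rewrite asbool_neg.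
set x := (count _ _)%:R%R in e *; set y := (count _ _)%:R%R in e *.
have -> : (x / (growth S n)%:R - 1 = - (y / (growth S n)%:R))%R.
  have -> : x = ((growth S n)%:R - y)%R by rewrite e addrK.
  by rewrite mulrBl divff ?lt0r_neq0 // addrAC subrr add0r.
by rewrite normrN ger0_norm // divr_ge0 // ltW.
Qed.
End BallProportion.

Theorem corollary1p8 (R : realType) (A B G : groupType)
    (iA : {multiplicative A -> G}) (iB : {multiplicative B -> G})
    (hG : is_free_product iA iB)
    (hA : nontrivial A) (hB : nontrivial B)
    (fgA : finitely_generated A) (fgB : finitely_generated B)
    (hne : ~ iso_Z2_free_Z2 G)
    (S : {fset G}) (hS : generates S) :
  exponentially_generic R S
    [set g : G | ~ conjugate_into iA g /\ ~ conjugate_into iB g].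
Proof.
have [b0 [b1 [a0 [a1 [nb0 nb1 na0 na1 n01]]]]] := two_syllables hG hA hB hne.
have [pA [pB [len nf]]] := free_product_syllables hG.
have [CA [TA [TA0 HA]]] := elliptic_growth_tight hS nf nb0 nb1 na0 na1 n01.
have n01' : (a0, b0) <> (a1, b1) by move=> [ea eb]; apply: n01; rewrite ea eb.
have [CB [TB [TB0 HB]]] :=
  elliptic_growth_tight hS (syllables_swap nf) na0 na1 nb0 nb1 n01'.
have T0 : (0 < TA + TB)%N by rewrite addn_gt0 TA0.
have [c [lambda [c0 l01 Hc]]] := geometric_bound R (CA + CB) T0.
exists c, lambda; split=> // n; rewrite ball_proportion_dist //.
apply: Hc; first exact: growth_gt0.
pose ell (i : G -> Prop) := [seq g <- wball S n | `[< i g >]].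
have ellP i g : g \in ell i -> (wnorm S g <= n)%N /\ i g.
  by rewrite mem_filter mem_wball // => /andP [/asboolP].
set bad := count _ _.
have le_bad : (bad <= size (ell (conjugate_into iA)) + size (ell (conjugate_into iB)))%N.
  rewrite !size_filter -count_predUI.
  apply: leq_trans (leq_addr _ _); apply: sub_count => g /asboolP /= nX.
  apply/orP; apply: contrapT => /not_orP [nA nB]; apply: nX.
  by split=> h; [apply: nA | apply: nB]; apply/asboolP.
have lA := HA n _ (filter_uniq _ (uniq_wball S n)) (ellP (conjugate_into iA)).
have lB := HB n _ (filter_uniq _ (uniq_wball S n)) (ellP (conjugate_into iB)).
have T_le T : (0 < T)%N -> (T <= TA + TB)%N -> (2 ^ (n %/ (TA + TB)) <= 2 ^ (n %/ T))%N.
  by move=> T0' le; rewrite leq_exp2l // leq_div2l.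
apply: leq_trans (leq_mul le_bad (leqnn _)) _.
rewrite mulnDl (mulnDl CA) (mulnDl (CA * _)%N); apply: leq_add.
  by apply: leq_trans lA; rewrite leq_mul2l T_le ?leq_addr ?orbT.
by apply: leq_trans lB; rewrite leq_mul2l T_le ?leq_addl ?orbT.
Qed.
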